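(* Let $k\ge 3$ be a fixed integer. Then the largest bias $b=b(n)$ for which Walker has a winning strategy in the $(1:b)$ Walker-Breaker $C_k$-game on $K_n$ is of order $\Theta\big(n^{\frac{k-2}{k-1}}\big)$.
   Context: A $(1:b)$ Walker-Breaker game on $K_n$ is played as follows. Walker and Breaker alternately claim edges of the complete graph $K_n$. At every moment Walker has a position, a vertex $v$. In her move Walker must choose an edge $vw$ incident with her current position $v$ which has not been claimed by Breaker (it may have been claimed by Walker before); she claims this edge (if not already hers) and $w$ becomes her new position. In each of his moves Breaker claims $b$ edges not claimed by either player so far. In the $C_k$-game, Walker wins if the graph of her claimed edges contains a cycle of length $k$; otherwise Breaker wins. Asymptotic notation is with respect to $n\to\infty$. *)

(* Defs.v *)
From mathcomp Require Import all_boot.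

Set Implicit Arguments.
Unset Strict Implicit.
Unset Printing Implicit Defensive.

Section WalkerBreaker.
Variable n : nat.

(* An edge of K_n is a two-element set of vertices. *)
Definition Kn_edges : {set {set 'I_n}} := [set e : {set 'I_n} | #|e| == 2].

Record board := Board {
  walker_edges : {set {set 'I_n}};
  breaker_edges : {set {set 'I_n}};
  walker_at : 'I_n }.

Definition initial_board (v0 : 'I_n) : board := Board set0 set0 v0.

Definition free_edges (s : board) : {set {set 'I_n}} :=
  Kn_edges :\: (walker_edges s :|: breaker_edges s).

Definition walker_legal (s : board) (w : 'I_n) : bool :=
  ([set walker_at s; w] \in Kn_edges) &&
  ([set walker_at s; w] \notin breaker_edges s).

(* The minimum only matters in the last move, when fewer than b edges remain:
   Breaker then claims all of them. *)
Definition breaker_legal (b : nat) (s : board) (F : {set {set 'I_n}}) : bool :=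
  (F \subset free_edges s) && (#|F| == minn b #|free_edges s|).

(* The board is left unchanged only if w is not a legal move. For a valid
   strategy (see below) this means that Walker has no legal move at all; she is
   then stuck for good and her graph never changes again. *)
Definition walker_move (s : board) (w : 'I_n) : board :=
  if walker_legal s w then
    Board ([set walker_at s; w] |: walker_edges s) (breaker_edges s) w
  else s.

Definition breaker_move (s : board) (F : {set {set 'I_n}}) : board :=
  Board (walker_edges s) (breaker_edges s :|: F) (walker_at s).

(* A strategy is given the list of the boards at the beginning of all previous
   rounds (most recent first) and the current board. *)
Definition walker_strategy := seq board -> board -> 'I_n.
Definition breaker_strategy := seq board -> board -> {set {set 'I_n}}.

Definition walker_strategy_valid (sigma : walker_strategy) : Prop :=
  forall h s, (exists w, walker_legal s w) -> walker_legal s (sigma h s).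

Definition breaker_strategy_valid (b : nat) (tau : breaker_strategy) : Prop :=
  forall h s, breaker_legal b s (tau h s).

(* Past boards and current board after t rounds; Walker moves first. *)
Fixpoint play (sigma : walker_strategy) (tau : breaker_strategy) (v0 : 'I_n)
    (t : nat) : seq board * board :=
  if t is t'.+1 then
    let: (h, s) := play sigma tau v0 t' in
    let s' := walker_move s (sigma h s) in
    (s :: h, breaker_move s' (tau (s :: h) s'))
  else ([::], initial_board v0).

Definition has_cycle (k : nat) (E : {set {set 'I_n}}) : Prop :=
  exists c : seq 'I_n,
    size c = k /\ ucycle (fun x y => [set x; y] \in E) c.

(* Walker chooses her starting vertex v0. *)
Definition walker_wins (k b : nat) : Prop :=
  exists (v0 : 'I_n) (sigma : walker_strategy),
    walker_strategy_valid sigma /\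
    forall tau : breaker_strategy, breaker_strategy_valid b tau ->
      exists t : nat, has_cycle k (walker_edges (play sigma tau v0 t).2).

Definition largest_winning_bias (k b : nat) : Prop :=
  walker_wins k b /\ forall b', walker_wins k b' -> b' <= b.

End WalkerBreaker.

(* Main.v *)
(** Write [d] for the integer part of the [(k-1)]-st root of [n], so that the claimed order
    is [d^(k-2)].

    Breaker, with bias at least [(k+1)(d+1)^(k-2)]: whenever Walker takes a new edge [vw],
    Breaker takes [(d+1)^(k-2)] edges at [v] and as many at [w], which keeps all degrees of
    Walker's graph at most [d+1]. Hence at most [(k-1)(d+1)^(k-2)] paths with [k-1] edges run
    through [vw], and Breaker also takes every free edge that joins the ends of such a path.
    No [C_k] can then be closed.

    Walker, with bias [c d^(k-2)]: split the vertices into [k] classes of linear size. Sitting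
    at a vertex [u] of class [j+1], Walker goes back and forth to [d] vertices of class [j];
    meanwhile Breaker claims only a small fraction of [n] edges, so almost all targets stay
    available at each step. Doing this for linearly many [u], class after class, and always
    choosing targets whose sets of endpoints in class [0] are not half covered yet and which
    have not been chosen too often, Walker reaches from every processed vertex of class [j]
    at least [(d/2)^j] vertices of class [0] by paths through classes [j, j-1, ..., 0]. From a
    vertex [u] of class [k-2] with more than [4b] such endpoints of small Breaker degree she
    steps to a vertex of class [k-1] which has free edges to half of these endpoints; Breaker
    cannot block all of them, and she closes a [C_k]. *)

Require Import Defs.
From mathcomp Require Import all_boot zify boolp.

Set Implicit Arguments.
Unset Strict Implicit.
Unset Printing Implicit Defensive.

(** * Finite sets and neighbourhoods *)

Lemma subset_of_card (T : finType) (A : {set T}) j :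
  j <= #|A| -> exists2 Z : {set T}, Z \subset A & #|Z| = j.
Proof.
move=> jA; exists [set x in take j (enum A)].
  by apply/subsetP=> x; rewrite inE => /mem_take; rewrite mem_enum.
by rewrite cardsE (card_uniqP _) ?take_uniq ?enum_uniq// size_take_min -cardE; lia.
Qed.

Lemma subset_between (T : finType) (R A : {set T}) j :
  R \subset A -> #|R| <= j <= #|A| ->
  exists F : {set T}, [/\ R \subset F, F \subset A & #|F| = j].
Proof.
move=> RA /andP[Rj jA].
have [|Z ZA cZ] := @subset_of_card _ (A :\: R) (j - #|R|).
  by have := cardsID R A; rewrite (setIidPr RA); lia.
exists (R :|: Z); split; first exact: subsetUl.
  by rewrite subUset RA (subset_trans ZA) ?subsetDl.
have dRZ : R :&: Z = set0.
  apply/setP=> x; rewrite !inE; apply/negP=> /andP[xR /(subsetP ZA)].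
  by rewrite inE xR.
by have := cardsUI R Z; rewrite dRZ cards0; lia.
Qed.

(** Double counting of the pairs related by [r]: a heavy [x] lies in at least c/m of them, each [y]
    in at most [D]. *)
Lemma card_heavy_le (S T : finType) (A : {set S}) (B : {set T})
    (r : S -> T -> bool) c m D :
  (forall y, y \in B -> #|[set x in A | r x y]| <= D) ->
  #|[set x in A | c <= m * #|[set y in B | r x y]|]| * c <= m * (#|B| * D).
Proof.
move=> HD; set H := [set x in A | _].
apply: (@leq_trans (m * \sum_(x in A) #|[set y in B | r x y]|)).
  rewrite -sum_nat_const big_distrr /= [X in _ <= X](bigID (mem H)) /=.
  apply: leq_trans (leq_addr _ _); rewrite [X in _ <= X](eq_bigl (mem H)).
    by apply: leq_sum => x; rewrite inE => /andP[].
  by move=> x; rewrite !inE; case: (x \in A).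
rewrite leq_mul2l; apply/orP; right.
rewrite -sum_nat_const (eq_bigr (fun x => \sum_(y in B) r x y)); last first.
  move=> x _; rewrite -sum1_card big_mkcond /= [RHS]big_mkcond /=.
  by apply: eq_bigr => y _; rewrite inE; case: (y \in B) => //=; case: (r x y).
rewrite exchange_big /=; apply: leq_sum => y yB; apply: leq_trans (HD y yB).
rewrite -sum1_card big_mkcond /= [X in _ <= X]big_mkcond /=.
by apply: leq_sum => x _; rewrite inE; case: (x \in A) => //=; case: (r x y).
Qed.

Lemma cardsU_le (T : finType) (A B : {set T}) a c :
  #|A| <= a -> #|B| <= c -> #|A :|: B| <= a + c.
Proof. by move=> hA hB; apply: leq_trans (leq_of_leqif (leq_card_setU A B)) (leq_add hA hB). Qed.

Lemma exists_notin (T : finType) (A B : {set T}) :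
  #|B| < #|A| -> exists2 x, x \in A & x \notin B.
Proof.
move=> BA; have [/subset_leq_card|/subsetPn//] := boolP (A \subset B).
by lia.
Qed.

Lemma card_bigcup_le (T S : finType) (A : {set S}) (f : S -> {set T}) c :
  (forall z, z \in A -> #|f z| <= c) -> #|\bigcup_(z in A) f z| <= #|A| * c.
Proof.
move=> H; rewrite -sum_nat_const.
apply: (@leq_trans (\sum_(z in A) #|f z|)); last exact: leq_sum.
elim/big_rec2: _ => [|z m U _ IH]; first by rewrite cards0.
by have := leq_of_leqif (leq_card_setU (f z) U); lia.
Qed.

Section Neighbourhoods.
Variable n : nat.
Implicit Types (E F : {set {set 'I_n}}) (u v w x y z : 'I_n).

Lemma set2_inj u : injective (fun z => [set u; z]).
Proof.
move=> z z' /= e.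
have : z \in [set u; z'] by rewrite -e set22.
have : z' \in [set u; z] by rewrite e set22.
by rewrite !inE => /orP[/eqP->|/eqP->] // /orP[/eqP->|/eqP->].
Qed.

Definition nbrs E u : {set 'I_n} := [set z | [set u; z] \in E].
Definition deg E u := #|nbrs E u|.

Lemma in_nbrs E u z : (z \in nbrs E u) = ([set u; z] \in E).
Proof. by rewrite inE. Qed.

Lemma nbrsC E u z : (z \in nbrs E u) = (u \in nbrs E z).
Proof. by rewrite !in_nbrs setUC. Qed.

Lemma degS E F u : E \subset F -> deg E u <= deg F u.
Proof. by move=> /subsetP EF; apply/subset_leq_card/subsetP=> z; rewrite !inE => /EF. Qed.

Lemma deg_le_card E u : deg E u <= #|E|.
Proof.
rewrite /deg -(card_imset (nbrs E u) (@set2_inj u)); apply/subset_leq_card/subsetP=> e.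
by move=> /imsetP[z]; rewrite inE => ? ->.
Qed.

Lemma deg_setU E F u : deg (E :|: F) u <= deg E u + deg F u.
Proof.
apply: leq_trans (leq_card_setU (nbrs E u) (nbrs F u)).
by apply/subset_leq_card/subsetP=> z; rewrite !inE.
Qed.

Lemma deg_le_n E u : deg E u <= n.
Proof. by rewrite -[X in _ <= X](card_ord n) max_card. Qed.

Lemma in_Kn u w : ([set u; w] \in Kn_edges n) = (u != w).
Proof. by rewrite inE cards2 eqSS; case: (u != w). Qed.

Lemma card_high_degree E c m :
  E \subset Kn_edges n -> #|[set u | c <= m * deg E u]| * c <= m * (#|E| * 2).
Proof.
move=> /subsetP EK.
apply: (@leq_trans (#|[set u in [set: 'I_n] | c <= m * #|[set e in E | u \in e]|]| * c)).
  rewrite leq_mul2r; apply/orP; right; apply/subset_leq_card/subsetP=> u.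
  rewrite !inE => /leq_trans; apply; rewrite leq_mul2l; apply/orP; right.
  rewrite /deg -(card_imset (nbrs E u) (@set2_inj u)); apply/subset_leq_card/subsetP=> e.
  by move=> /imsetP[z]; rewrite inE => ? ->; rewrite inE set21 andbT.
apply: (@card_heavy_le _ _ [set: 'I_n] E (fun u e => u \in e)) => e /EK; rewrite inE => /eqP <-.
by apply/subset_leq_card/subsetP=> u; rewrite !inE.
Qed.

End Neighbourhoods.

(** * Strategies from local moves *)

Section Strategies.
Variables (n b : nat).
Implicit Types (s : board n) (w : 'I_n) (F : {set {set 'I_n}}).

Definition round s w F := breaker_move (walker_move s w) F.

Lemma breaker_legal_extend s (R : {set {set 'I_n}}) :
  R \subset free_edges s -> #|R| <= b ->
  exists2 F : {set {set 'I_n}}, R \subset F & breaker_legal b s F.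
Proof.
move=> Rf Rb; have [|F [RF Ff cF]] := @subset_between _ R _ (minn b #|free_edges s|) Rf.
  by have := subset_leq_card Rf; lia.
by exists F => //; rewrite /breaker_legal Ff cF /=.
Qed.

(** On every board, Breaker's strategy picks by choice a legal move that yields [Inv] if there is
    one, and any legal move otherwise, since validity also concerns boards that never occur. *)
Lemma breaker_wins k (Inv : board n -> Prop) :
  (forall v0, Inv (initial_board v0)) ->
  (forall s w, Inv s -> exists2 F, breaker_legal b (walker_move s w) F & Inv (round s w F)) ->
  (forall s, Inv s -> ~ has_cycle k (walker_edges s)) ->
  ~ walker_wins n k b.
Proof.
move=> Inv0 InvS Invk [v0 [sigma [_ win]]].
pose good s F := breaker_legal b s F /\
  ((exists2 F, breaker_legal b s F & Inv (breaker_move s F)) -> Inv (breaker_move s F)).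
have ex_good s : exists F, good s F.
  have [e|ne] := pselect (exists2 F, breaker_legal b s F & Inv (breaker_move s F)).
    by have [F lF iF] := e; exists F.
  by have [||F _ lF] := @breaker_legal_extend s set0; rewrite ?sub0set ?cards0//; exists F.
pose tau (h : seq (board n)) s := projT1 (cid (ex_good s)).
have tauP h s : good s (tau h s) := projT2 (cid (ex_good s)).
have [|t] := win tau; first by move=> h s; have [] := tauP h s.
apply: Invk; elim: t => [|t /=]; first exact: Inv0.
case: (play sigma tau v0 t) => h s /= Is.
have [_] := tauP (s :: h) (walker_move s (sigma h s)); apply.
exact: InvS.
Qed.

(* Walker can play so that [X] holds after exactly [t] rounds. *)
Fixpoint forces t (X : board n -> Prop) s : Prop :=
  if t is t'.+1 then
    exists2 w, walker_legal s w &
      forall F, breaker_legal b (walker_move s w) F -> forces t' X (round s w F)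
  else X s.

(** The length of the history serves as a clock: after [size h] rounds Walker plays a move from
    which [X] can still be forced in the remaining [t - (size h).+1] rounds, if such a move
    exists. *)
Lemma forces_wins k t v0 :
  forces t (fun s => has_cycle k (walker_edges s)) (initial_board v0) ->
  walker_wins n k b.
Proof.
set X := (fun s => _) => fX; exists v0.
pose winning t s w := forall F, breaker_legal b (walker_move s w) F -> forces t X (round s w F).
pose good (h : seq (board n)) s w :=
  ((exists w, walker_legal s w) -> walker_legal s w) /\
  ((exists2 w, walker_legal s w & winning (t - (size h).+1) s w) ->
    walker_legal s w /\ winning (t - (size h).+1) s w).
have ex_good h s : exists w, good h s w.
  have [e|ne] := pselect (exists2 w, walker_legal s w & winning (t - (size h).+1) s w).
    by have [w lw ww] := e; exists w.
  have [[w lw]|nl] := pselect (exists w, walker_legal s w); first by exists w.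
  (* There is no legal move, so both demands are vacuous and [v0] is a default value. *)
  by exists v0; split.
pose sigma h s := projT1 (cid (ex_good h s)).
have sigmaP h s : good h s (sigma h s) := projT2 (cid (ex_good h s)).
exists sigma; split; first by move=> h s; have [] := sigmaP h s.
move=> tau tauP; exists t.
suff H i : i <= t -> size (play sigma tau v0 i).1 = i /\
    forces (t - i) X (play sigma tau v0 i).2.
  by have [//|_] := H t; rewrite subnn.
elim: i => [|i IH] it; first by rewrite subn0.
have [] := IH (ltnW it).
rewrite /=; case: (play sigma tau v0 i) => h s /= sh.
rewrite (_ : t - i = (t - i.+1).+1) /=; last by lia.
move=> fs; split; first by rewrite sh.
have [_] := sigmaP h s; rewrite sh => /(_ fs) [_]; apply.
exact: tauP.
Qed.

Lemma forces_mono t (X Y : board n -> Prop) s :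
  (forall s', X s' -> Y s') -> forces t X s -> forces t Y s.
Proof.
move=> XY; elim: t s => [|t IH] s /=; first exact: XY.
by move=> [w lw H]; exists w => // F /H /IH.
Qed.

Lemma forces_bind t1 t2 X s :
  forces t1 (forces t2 X) s -> forces (t1 + t2) X s.
Proof.
elim: t1 s => [|t IH] s //=.
by move=> [w lw H]; exists w => // F /H /IH.
Qed.

Definition wf_board s :=
  [disjoint walker_edges s & breaker_edges s] /\ breaker_edges s \subset Kn_edges n.

(** All that a later phase has to know about [t] rounds of play. *)
Definition evolves t s s' :=
  [/\ wf_board s', walker_edges s \subset walker_edges s' &
   exists2 F : {set {set 'I_n}}, breaker_edges s' = breaker_edges s :|: F & #|F| <= t * b].

Lemma evolves_refl s : wf_board s -> evolves 0 s s.
Proof. by move=> wf; split=> //; exists set0; rewrite ?setU0 ?cards0. Qed.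

Lemma evolves_trans t1 t2 s1 s2 s3 :
  evolves t1 s1 s2 -> evolves t2 s2 s3 -> evolves (t1 + t2) s1 s3.
Proof.
move=> [_ W12 [F1 B12 c1]] [wf3 W23 [F2 B23 c2]]; split=> //.
  exact: subset_trans W23.
exists (F1 :|: F2); first by rewrite B23 B12 setUA.
by rewrite mulnDl; have := leq_of_leqif (leq_card_setU F1 F2); lia.
Qed.

Lemma evolves_round s w F :
  wf_board s -> walker_legal s w -> breaker_legal b (walker_move s w) F ->
  evolves 1 s (round s w F).
Proof.
move=> [dWB BK] lw; rewrite /breaker_legal /walker_move lw => /andP[Ff /eqP cF].
have /andP[eK eB] := lw; rewrite /round /walker_move lw /=.
have dF x : x \in F -> x \in Kn_edges n /\
    x \notin [set walker_at s; w] |: walker_edges s.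
  move=> /(subsetP Ff); rewrite inE /= => /andP[]; rewrite in_setU negb_or.
  by move=> /andP[].
split=> /=; first split=> /=.
- apply/pred0P=> x /=; apply/negP=> /andP[xW]; rewrite in_setU => /orP[xB|/dF[_]].
    move: xW; rewrite in_setU1 => /orP[/eqP xe|xW]; first by rewrite -xe xB in eB.
    by have := disjointFr dWB xW; rewrite xB.
  by rewrite xW.
- by rewrite subUset BK; apply/subsetP=> x /dF[].
- exact: subsetUr.
- by exists F => //; rewrite cF mul1n geq_minl.
Qed.

Lemma forces_evolves t X s :
  wf_board s -> forces t X s -> forces t (fun s' => X s' /\ evolves t s s') s.
Proof.
elim: t s => [|t IH] s wf /=; first by move=> Xs; split=> //; exact: evolves_refl.
move=> [w lw H]; exists w => // F lF.
have es := evolves_round wf lw lF; have [wf' _ _] := es.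
have := IH _ wf' (H F lF); apply: forces_mono => s' [Xs' e']; split=> //.
by rewrite -add1n; apply: evolves_trans e'.
Qed.

Lemma forces_seq t1 t2 X Y s :
  wf_board s -> forces t1 X s ->
  (forall s', X s' -> evolves t1 s s' -> forces t2 Y s') ->
  forces (t1 + t2) Y s.
Proof.
move=> wf fX H; apply: forces_bind; have := forces_evolves wf fX.
by apply: forces_mono => s' [] /H.
Qed.

Lemma wf_initial v0 : wf_board (initial_board v0).
Proof. by split; rewrite ?sub0set// -setI_eq0 set0I. Qed.

Lemma evolves_deg t s s' u :
  evolves t s s' -> deg (breaker_edges s') u <= deg (breaker_edges s) u + t * b.
Proof.
move=> [_ _ [F -> cF]]; have := deg_setU (breaker_edges s) F u.
by have := deg_le_card F u; lia.
Qed.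

Lemma evolves_card t s s' :
  evolves t s s' -> #|breaker_edges s'| <= #|breaker_edges s| + t * b.
Proof.
move=> [_ _ [F -> cF]]; have := leq_of_leqif (leq_card_setU (breaker_edges s) F).
by lia.
Qed.

Lemma forces_step X s w :
  wf_board s -> walker_at s != w -> [set walker_at s; w] \notin breaker_edges s ->
  (forall s', evolves 1 s s' -> walker_at s' = w ->
    [set walker_at s; w] \in walker_edges s' -> X s') ->
  forces 1 X s.
Proof.
move=> wf vw eB H; have lw : walker_legal s w by rewrite /walker_legal in_Kn vw.
exists w => // F lF; apply: H; first exact: evolves_round.
  by rewrite /round /walker_move lw.
by rewrite /round /walker_move lw /= setU11.
Qed.

End Strategies.

(** * Breaker's strategy *)

Section Breaker.
Variable n : nat.
Implicit Types (W B : {set {set 'I_n}}) (u v w x y z : 'I_n) (p : seq 'I_n).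

Definition adj W : rel 'I_n := fun x y => [set x; y] \in W.

(** Ends of the walks with exactly [i] edges from [v]; vertices may repeat, so this is not a metric
    sphere. *)
Fixpoint sphere W i v : {set 'I_n} :=
  if i is i'.+1 then \bigcup_(z in sphere W i' v) nbrs W z else [set v].

Lemma card_sphere W D i v : (forall u, deg W u <= D) -> #|sphere W i v| <= D ^ i.
Proof.
move=> HD; elim: i => [|i IH] /=; first by rewrite cards1.
rewrite expnSr; apply: leq_trans (leq_mul IH (leqnn D)).
by apply: card_bigcup_le => z _; apply: HD.
Qed.

Lemma last_in_sphere W x p : path (adj W) x p -> last x p \in sphere W (size p) x.
Proof.
elim/last_ind: p => [|p y IH] /=; first by rewrite set11.
rewrite rcons_path size_rcons last_rcons => /andP[/IH h a].
by apply/bigcupP; exists (last x p); rewrite // in_nbrs.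
Qed.

Lemma head_in_sphere W x p : path (adj W) x p -> x \in sphere W (size p) (last x p).
Proof.
elim: p x => [|y p IH] x /=; first by rewrite set11.
move=> /andP[a /IH h]; apply/bigcupP; exists y => //.
by rewrite nbrsC in_nbrs.
Qed.

(* Contains the end pair of every walk of [j.+1] edges through [vw], whichever way it
   traverses [vw], because edges are unordered pairs. *)
Definition span W j v w : {set {set 'I_n}} :=
  \bigcup_(i in [set: 'I_j.+1])
    [set [set q.1; q.2] | q in setX (sphere W i v) (sphere W (j - i) w)].

(** For each of the j+1 positions of [vw] on the walk there are at most D^i choices for one end and
    D^(j-i) for the other. *)
Lemma card_span W D j v w :
  (forall u, deg W u <= D) -> #|span W j v w| <= j.+1 * D ^ j.
Proof.
move=> HD; apply: (@leq_trans (#|[set: 'I_j.+1]| * D ^ j)); last by rewrite cardsT card_ord.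
apply: card_bigcup_le => i _; apply: leq_trans (leq_imset_card _ _) _; rewrite cardsX.
have -> : D ^ j = D ^ i * D ^ (j - i) by rewrite -expnD subnKC // -ltnS.
by apply: leq_mul; apply: card_sphere.
Qed.

Lemma in_span W j v w i x y : i <= j -> x \in sphere W i v -> y \in sphere W (j - i) w ->
  [set x; y] \in span W j v w.
Proof.
move=> ij xS yS; apply/bigcupP; exists (inord i) => //.
by apply/imsetP; exists (x, y); rewrite // inE /= inordK ?xS ?yS// ltnS.
Qed.

Lemma path_new_edge W e x p :
  path (adj (e |: W)) x p -> ~~ path (adj W) x p ->
  exists p1 z p2, p = p1 ++ z :: p2 /\ [set last x p1; z] = e.
Proof.
elim: p x => [//|y p IH] x /= /andP[a pp].
rewrite negb_and => /orP[na|/IH-/(_ pp)[p1 [z [p2 [-> ez]]]]]; last first.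
  by exists (y :: p1), z, p2.
exists [::], y, p; split=> //=; move: a; rewrite /adj in_setU1 => /orP[/eqP//|a].
by rewrite /adj a in na.
Qed.

(** A path through the new edge is cut there into two walks, one from each end of [vw] to an end of
    the path, with [j] edges together. *)
Lemma new_path_ends W v w x p j : size p = j.+1 ->
  path (adj ([set v; w] |: W)) x p ->
  path (adj W) x p \/ [set x; last x p] \in span ([set v; w] |: W) j v w.
Proof.
move=> sp pp; have [|npW] := boolP (path (adj W) x p); [by left|right].
have [p1 [z [p2 [ep ez]]]] := path_new_edge pp npW.
move: pp sp; rewrite ep cat_path /= last_cat /= size_cat /= => /and3P[pp1 _ pp2] sp.
have h1 := head_in_sphere pp1; have h2 := last_in_sphere pp2.
have : last x p1 \in [set v; w] by rewrite -ez set21.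
rewrite !inE => /orP[/eqP e1|/eqP e1].
  rewrite e1 in h1 ez; rewrite (set2_inj ez) in h2 *.
  by apply: (@in_span _ _ _ _ (size p1)) => //; [lia | rewrite (_ : j - _ = size p2) //; lia].
rewrite e1 setUC in ez; rewrite e1 in h1.
have zv : z = v by move: ez; rewrite [RHS]setUC [LHS]setUC => /set2_inj.
rewrite zv in h2 *; rewrite setUC.
by apply: (@in_span _ _ _ _ (size p2)) => //; [lia | rewrite (_ : j - _ = size p1) //; lia].
Qed.

Lemma deg_setU1 e u W : deg (e |: W) u <= deg W u + (u \in e).
Proof.
apply: leq_trans (deg_setU _ _ _) _; rewrite addnC leq_add2l.
have [ue|nue] := boolP (u \in e).
  by apply: leq_trans (deg_le_card _ _) _; rewrite cards1.
rewrite leqn0 cards_eq0; apply/eqP/setP=> z; rewrite !inE.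
by apply/negP=> /eqP ez; rewrite -ez set21 in nue.
Qed.


(** In the left alternative [v] becomes saturated: Breaker takes all its free edges, fewer than [c],
    and no new edge of Walker can contain [v] any more. *)
Lemma star_edges W B v c : exists R : {set {set 'I_n}},
  [/\ R \subset Kn_edges n :\: (W :|: B), #|R| <= c &
   (forall z, z != v -> [set v; z] \in W :|: (B :|: R)) \/
   deg B v + c <= deg (B :|: R) v].
Proof.
pose Z := [set z | (z != v) && ([set v; z] \notin W :|: B)].
have [Z' Z'Z cZ'] := @subset_of_card _ Z (minn c #|Z|) (geq_minr _ _).
exists [set [set v; z] | z in Z']; split.
- apply/subsetP=> e /imsetP[z /(subsetP Z'Z)]; rewrite inE => /andP[zv nz ->].
  by rewrite in_setD nz in_Kn eq_sym.
- by rewrite card_imset ?cZ' ?geq_minl//; exact: set2_inj.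
have [cZ|Zc] := leqP c #|Z|; [right|left].
  have dZ : nbrs B v :&: Z' = set0.
    apply/setP=> z; rewrite !inE; apply/negP=> /andP[zB /(subsetP Z'Z)].
    by rewrite !inE zB orbT andbF.
  have := cardsUI (nbrs B v) Z'; rewrite dZ cards0 cZ' (minn_idPl cZ) addn0 => <-.
  apply/subset_leq_card/subsetP=> z; rewrite !inE => /orP[->//|zZ].
  by apply/orP; right; apply/imsetP; exists z.
have {Z'Z} -> : Z' = Z by apply/eqP; rewrite eqEcard Z'Z cZ'; lia.
move=> z zv; rewrite setUA in_setU; have [//|nz] := boolP (_ \in _ :|: B).
by apply/imsetP; exists z; rewrite // inE zv.
Qed.

(** Only the first edge of the path contains [x], and as there are at least two edges it does not
    lead to the last vertex. *)
Lemma path_without_closing W x p : uniq (x :: p) -> 1 < size p ->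
  path (adj ([set x; last x p] |: W)) x p -> path (adj W) x p.
Proof.
case: p => [//|y p] /=; rewrite inE negb_or => /and3P[/andP[xy xp] yp up] sp /andP[].
rewrite {1}/adj in_setU1 => /orP[/eqP/set2_inj ey|axy] pp.
  by case: p yp sp ey {xp up pp} => [//|z p] /negP yp _ /= ey; case: yp; rewrite ey mem_last.
rewrite /adj axy /=; apply: (@sub_in_path _ [pred z | z != x]) pp; last first.
  rewrite /= eq_sym xy; apply/allP=> z zp /=; apply/eqP=> zx.
  by rewrite -zx zp in xp.
move=> a c; rewrite !inE => ax cx; rewrite /adj in_setU1 => /orP[/eqP ee|//].
have : x \in [set a; c] by rewrite ee set21.
by rewrite !inE => /orP[] /eqP xx; [rewrite xx eqxx in ax | rewrite xx eqxx in cx].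
Qed.

(** In the third clause [u] is saturated or has [b'] Breaker edges per Walker edge; as degrees are
    at most [n], this bounds Walker's degrees. The last clause keeps Breaker one move ahead: every
    path of k-1 edges is already blocked. *)
Definition breaker_inv k D b' (s : board n) :=
  [/\ forall e, e \in walker_edges s -> e \notin breaker_edges s,
   forall u, deg (walker_edges s) u <= D,
   forall u, (forall z, z != u -> [set u; z] \in walker_edges s :|: breaker_edges s) \/
     b' * deg (walker_edges s) u <= deg (breaker_edges s) u &
   forall x p, size p = k.-1 -> uniq (x :: p) -> path (adj (walker_edges s)) x p ->
     [set x; last x p] \in breaker_edges s].


Lemma breaker_inv_cycle k D b' s : 0 < k ->
  breaker_inv k D b' s -> ~ has_cycle k (walker_edges s).
Proof.
move=> k0 [dWB _ _ Hp] [[|x p] [/= sc]]; first by rewrite -sc in k0.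
case/andP; rewrite /= rcons_path => /andP[pp cl] up.
have := dWB _ cl; rewrite setUC Hp //.
by rewrite -sc.
Qed.

Lemma breaker_inv_initial k D b' v0 : 1 < k -> breaker_inv k D b' (initial_board v0).
Proof.
move=> k1; have d0 u : deg (set0 : {set {set 'I_n}}) u = 0.
  by apply/eqP; rewrite -leqn0; have := deg_le_card (set0 : {set {set 'I_n}}) u; rewrite cards0.
split=> /=.
- by move=> e; rewrite inE.
- by move=> u; rewrite d0.
- by move=> u; right; rewrite d0 muln0.
- by move=> x [|y p] /= sp; [lia | move=> _; rewrite {1}/adj in_set0].
Qed.

Lemma breaker_inv_same_walker k D b' s s' :
  breaker_inv k D b' s -> walker_edges s' = walker_edges s ->
  breaker_edges s \subset breaker_edges s' ->
  (forall e, e \in walker_edges s' -> e \notin breaker_edges s') ->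
  breaker_inv k D b' s'.
Proof.
move=> [dWB HD Hb Hp] eW BB dWB'; split=> //; rewrite eW //.
  move=> u; have [Hu|Hu] := Hb u; [left|right].
    by move=> z /Hu; apply/subsetP/setUS.
  exact: leq_trans (degS _ BB).
by move=> x p sp up pp; apply: (subsetP BB); apply: Hp.
Qed.

(** The bias pays for [b'] edges at each end of the new edge and for the free edges of its
    [span]. *)
Lemma breaker_inv_round k b b' D s w : 3 <= k -> 0 < b' -> D = (n %/ b').+1 ->
  b' + b' + k.-1 * D ^ k.-2 <= b ->
  breaker_inv k D b' s ->
  exists2 F, breaker_legal b (walker_move s w) F & breaker_inv k D b' (round s w F).
Proof.
move=> k3 b'0 eD Hbb inv; have k1 : k.-1 = k.-2.+1 by clear -k3; lia.
have k2 : 0 < k.-2 by clear -k3; lia.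
 have [dWB HD Hb Hp] := inv.
set v := walker_at s; set e := [set v; w].
have dF (s' : board n) F : breaker_legal b s' F ->
    forall f, f \in F -> f \notin walker_edges s'.
  move=> /andP[/subsetP Ff _] f /Ff; rewrite in_setD in_setU negb_or.
  by case/andP=> /andP[].
(* If Walker takes no new edge, any legal answer preserves the invariant. *)
have [/andP[lw eW]|nnew] := boolP (walker_legal s w && (e \notin walker_edges s)); last first.
  have eW : walker_edges (walker_move s w) = walker_edges s.
    rewrite /walker_move; case: ifP => //= lw; apply/setUidPr; rewrite sub1set.
    by move: nnew; rewrite lw negbK.
  have eB : breaker_edges (walker_move s w) = breaker_edges s.
    by rewrite /walker_move; case: ifP.
  have [||F _ lF] := @breaker_legal_extend n b (walker_move s w) set0; rewrite ?sub0set ?cards0//.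
  exists F => //; apply: (breaker_inv_same_walker inv) => //=; rewrite eB ?subsetUl// eW.
  move=> f fW; rewrite in_setU negb_or dWB //=; apply/negP=> /(dF _ _ lF).
  by rewrite eW fW.
have /andP[eK eB] := lw; rewrite -/v -/e in eK eB.
set s' := walker_move s w.
set W := walker_edges s in dWB HD Hb Hp eW *; set B := breaker_edges s in dWB Hb Hp eB *.
have es' : s' = Board (e |: W) B w by rewrite /s' /walker_move lw.
have vw : v != w by rewrite -in_Kn.
(* The new edge was free, so its ends are not saturated, and Breaker's degree, at most [n], bounds
   Walker's old degree by [n %/ b']. *)
have HW u : u \in e -> deg W u <= n %/ b' /\ b' * deg W u <= deg B u.
  move=> ue; have [fu|Hu] := Hb u.
    have [z zu ez] : exists2 z, z != u & [set u; z] = e.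
      move: ue; rewrite !inE => /orP[/eqP->|/eqP->].
        by exists w; rewrite // eq_sym.
      by exists v; rewrite // setUC.
    by have := fu z zu; rewrite ez in_setU (negPf eW) (negPf eB).
  by split=> //; rewrite leq_divRL // mulnC (leq_trans Hu) ?deg_le_n.
have HD' u : deg (e |: W) u <= D.
  apply: leq_trans (deg_setU1 e u W) _.
  have [/HW[Hu _]|_] := boolP (u \in e); last by rewrite addn0.
  by rewrite addn1 eD ltnS.
have [Rv [Rvf cRv HRv]] := star_edges (e |: W) B v b'.
have [Rw [Rwf cRw HRw]] := star_edges (e |: W) B w b'.
pose T := span (e |: W) k.-2 v w :&: free_edges s'.
have ff : free_edges s' = Kn_edges n :\: (e |: W :|: B) by rewrite es'.
have [||F RF lF] := @breaker_legal_extend n b s' (Rv :|: Rw :|: T).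
- by rewrite !subUset ff Rvf Rwf -ff subsetIr.
- apply: leq_trans (leq_of_leqif (leq_card_setU _ _)) _.
  have := leq_of_leqif (leq_card_setU Rv Rw).
  have := @card_span (e |: W) D k.-2 v w HD'.
  have := subset_leq_card (subsetIl (span (e |: W) k.-2 v w) (free_edges s')).
  rewrite -/T -k1; move: (k.-1 * _) Hbb => c; clear -cRv cRw; lia.
have dWF := dF _ _ lF; exists F => //; rewrite /round -/s'.
have /andP[/subsetP Ff _] := lF.
move: RF; rewrite !subUset => /andP[/andP[RvF RwF] TF].
split; rewrite es' /=.
- move=> f fW; rewrite in_setU negb_or; apply/andP; split; last first.
    by apply/negP=> /dWF; rewrite es' /= fW.
  by move: fW; rewrite in_setU1 => /orP[/eqP->//|/dWB].
- exact: HD'.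
- move=> u; have [ue|nue] := boolP (u \in e); last first.
    have dW := deg_setU1 e u W; rewrite (negPf nue) addn0 in dW.
    have [fu|Hu] := Hb u; [left=> z /fu|right].
      by apply/subsetP/setUSS; [exact: subsetUr|exact: subsetUl].
    apply: leq_trans (degS u (subsetUl B F)); apply: leq_trans Hu.
    by rewrite leq_mul2l dW orbT.
  have dW := deg_setU1 e u W; rewrite ue in dW.
  have [_ Hu] := HW u ue.
  have [R RF [fu|dR]] : exists2 R : {set {set 'I_n}}, R \subset F &
     (forall z, z != u -> [set u; z] \in e |: W :|: (B :|: R)) \/
     deg B u + b' <= deg (B :|: R) u.
  + by move: ue; rewrite !inE => /orP[/eqP->|/eqP->]; [exists Rv|exists Rw].
  + left=> z /fu; apply/subsetP; rewrite setUS// setUS//.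
  right; apply: leq_trans (degS u (setUS B RF)); apply: leq_trans dR.
  apply: (@leq_trans (b' * (deg W u + 1))); last by rewrite mulnDr muln1 leq_add2r.
  by apply: leq_mul.
move=> x p sp up pp.
have [pW|nW] := boolP (path (adj W) x p); first by rewrite in_setU Hp.
have [|inT] : path (adj W) x p \/ [set x; last x p] \in span (e |: W) k.-2 v w.
- by apply: new_path_ends; rewrite // sp.
- by rewrite (negPf nW).
rewrite in_setU; have [//|nB] := boolP ([set x; last x p] \in B).
apply: (subsetP TF); rewrite inE inT ff inE in_Kn in_setU (negPf nB) orbF.
have xl : x != last x p.
  case: p sp up {pp nW inT nB} => [|y p] /= sp; first by rewrite k1 in sp.
  by move=> /andP[/negP xp _]; apply/eqP=> xe; case: xp; rewrite xe mem_last.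
(* Were the closing edge Walker's, it would form with the path a cycle of length [k] through [vw].
   Going round from [z] and leaving out [vw] gives a path of k-1 old edges between the ends of [vw],
   so Breaker would already own [vw]. *)
rewrite xl andbT; apply/negP=> clW.
have [p1 [z [p2 [ep ez]]]] := path_new_edge pp nW.
have sp1 : 1 < size p by rewrite sp k1.
pose p' := p2 ++ x :: p1.
have lp : last x p = last z p2 by rewrite ep last_cat.
have lp' : last z p' = last x p1 by rewrite /p' last_cat.
have perm : perm_eq (z :: p') (x :: p).
  by rewrite ep /p' -cat_cons perm_catC.
have sp' : size p' = size p by have := perm_size perm => -[].
have up' : uniq (z :: p') by rewrite (perm_uniq perm).
have ee : [set z; last z p'] = e by rewrite lp' setUC.
have pW' : path (adj W) z p'.
  apply: path_without_closing => //; first by rewrite sp'.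
  rewrite ee /p' cat_path /=; move: pp; rewrite ep cat_path /= => /and3P[pp1 _ ->] /=.
  by rewrite pp1 andbT /adj setUC -lp.
by have := Hp z p'; rewrite sp' sp ee (negPf eB) => /(_ erefl up' pW').
Qed.

End Breaker.

(** With [b'] equal to (d+1)^(k-2), the bound on [n] makes Walker's degrees at most d+1. The factor
    k+1 is 2 for the stars plus k-1 for the paths. *)
Lemma breaker_prevents n k d b : 3 <= k -> n < d.+1 ^ k.-1 -> walker_wins n k b ->
  b < k.+1 * d.+1 ^ k.-2.
Proof.
move=> k3 nd ww; rewrite ltnNge; apply/negP=> bb.
have b'0 : 0 < d.+1 ^ k.-2 by rewrite expn_gt0.
have Dd : (n %/ d.+1 ^ k.-2).+1 <= d.+1.
  by rewrite ltn_divLR // -expnS (_ : k.-2.+1 = k.-1) //; lia.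
apply: (@breaker_wins n b k (breaker_inv k (n %/ d.+1 ^ k.-2).+1 (d.+1 ^ k.-2))) ww.
- by move=> v0; apply: breaker_inv_initial; lia.
- move=> s w; apply: breaker_inv_round => //.
  apply: leq_trans bb; rewrite (_ : k.+1 = 2 + k.-1); last by lia.
  rewrite mulnDl mul2n -addnn leq_add2l leq_mul2l leq_exp2r ?Dd ?orbT//; lia.
- by move=> s; apply: breaker_inv_cycle; lia.
Qed.

(** * Walker's strategy *)

Section Walker.
Variables (n b d p : nat) (col : 'I_n -> nat).
Implicit Types (s : board n) (u v w x y z : 'I_n) (W : {set {set 'I_n}}).
Implicit Types (P N Q K A : {set 'I_n}) (L : 'I_n -> {set 'I_n}).

(** Colours fall by one along the walk, which makes its vertices distinct. *)
Fixpoint reach W j v x : Prop :=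
  if j is j'.+1 then col v = j /\ exists2 z, [set v; z] \in W & reach W j' z x
  else v = x /\ col v = 0.

Lemma reachS W W' j v x : W \subset W' -> reach W j v x -> reach W' j v x.
Proof.
move=> /subsetP WW; elim: j v => [//|j IH] v /= [cv [z zW /IH rz]].
by split=> //; exists z => //; apply: WW.
Qed.

Lemma reach_path W j v x : reach W j v x -> exists q,
  [/\ size q = j, path (adj W) v q, last v q = x, uniq (v :: q) &
      forall y, y \in v :: q -> col y <= j].
Proof.
elim: j v => [|j IH] v /=.
  by move=> [<- cv]; exists [::]; split=> // y; rewrite inE => /eqP->; rewrite cv.
move=> [cv [z zW /IH[q [sq pq lq uq cq]]]]; exists (z :: q); split=> //.
- by rewrite /= sq.
- by rewrite /= pq andbT.
- rewrite uq andbT.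
  by apply/negP=> /cq; rewrite cv ltnn.
- move=> y; rewrite inE => /orP[/eqP->|/cq]; first by rewrite cv.
  exact: leqW.
Qed.

(* [P] is the set of processed vertices of class [j], and [L v] is the set of endpoints in
   class [0] collected for [v]. The last bound keeps the sets [L v] spread out, so that only
   few of them can meet a given small set in half of their elements. *)
Definition layer W j P L :=
  [/\ p <= #|P|, forall v, v \in P -> col v = j,
   forall v x, v \in P -> x \in L v -> reach W j v x,
   forall v, v \in P -> #|L v| <= d ^ j /\ d ^ j <= 2 ^ j * #|L v| &
   forall x, #|[set v in P | x \in L v]| <= (4 * d) ^ j].

Lemma layerS W W' j P L : W \subset W' -> layer W j P L -> layer W' j P L.
Proof.
move=> WW [cP colP rP sP iP]; split=> // v x vP xL.
by apply: reachS WW _; apply: rP.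
Qed.

Lemma layer0 W P : p <= #|P| -> (forall v, v \in P -> col v = 0) ->
  layer W 0 P (fun v => [set v]).
Proof.
move=> cP colP; split=> //.
- by move=> v x vP; rewrite inE => /eqP->; split=> //; apply: colP.
- by move=> v _; rewrite cards1.
- move=> x; rewrite expn0 -(cards1 x); apply/subset_leq_card/subsetP=> v.
  by rewrite !inE => /andP[_ /eqP->].
Qed.

Hypotheses (b0 : 0 < b) (d0 : 0 < d) (dbp : 16 * (d * b) <= p).

Lemma d_le_db : d <= d * b.
Proof. by rewrite leq_pmulr. Qed.

Lemma b_le_db : b <= d * b.
Proof. by rewrite leq_pmull. Qed.

(** Each counted [v] has at least d^j/2^(j+1) elements of [A] in [L v], and each element of [A] lies
    in at most (4d)^j of these sets; the powers of [d] cancel. *)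
Lemma card_overlapping W j P L A : layer W j P L ->
  #|[set v in P | #|L v| <= 2 * #|L v :&: A|]| <= 2 ^ j.+1 * 4 ^ j * #|A|.
Proof.
move=> [_ _ _ sP iP]; have dj : 0 < d ^ j by rewrite expn_gt0 d0.
rewrite -(leq_pmul2r dj).
have := @card_heavy_le _ _ P A (fun v x => x \in L v) (d ^ j) (2 ^ j.+1) ((4 * d) ^ j).
move=> /(_ (fun x _ => iP x)) H; apply: leq_trans (leq_trans H _); last first.
  by rewrite expnMn; lia.
rewrite leq_mul2r; apply/orP; right; apply/subset_leq_card/subsetP=> v.
rewrite !inE => /andP[vP vA]; rewrite vP /=; have [_ h] := sP v vP.
have -> : [set y in A | y \in L v] = L v :&: A by apply/setP=> y; rewrite !inE andbC.
by apply: leq_trans h _; rewrite expnSr -mulnA leq_mul2l vA orbT.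
Qed.

(* [Q] holds the targets that may not be chosen any more, [K] the endpoints not to be counted. *)
Definition star j P L Q K u i s :=
  walker_at s = u /\ exists N, [/\ N \subset P, #|N| = i, [disjoint N & Q],
    forall v, v \in N -> [set u; v] \in walker_edges s &
    i * d ^ j <= 2 ^ j.+1 * #|\bigcup_(v in N) (L v :\: K)|].

(** Each target takes two rounds, there and back. At least half of its [L v] lies outside [K] and
    the endpoints collected so far, which adds at least d^j/2^(j+1) new ones. *)
Lemma force_star j P L Q K s u i :
  wf_board s -> layer (walker_edges s) j P L -> walker_at s = u -> col u = j.+1 ->
  8 * deg (breaker_edges s) u <= p -> 4 * #|Q| <= p ->
  4 * (2 ^ j.+1 * 4 ^ j * (d ^ j.+1 + #|K|)) <= p -> i <= d ->
  forces b (2 * i) (star j P L Q K u i) s.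
Proof.
move=> wf lay atu colu degu cQ cK; have [cP colP _ sP _] := lay.
elim: i => [|i IH] id.
  split=> //; exists set0; split=> //; rewrite ?sub0set ?cards0 //.
  - by rewrite -setI_eq0 set0I.
  - by move=> v; rewrite inE.
rewrite mulnS addnC; apply: (forces_seq wf (IH (ltnW id))) => s1 [at1 [N [NP cN NQ NW NU]]] ev1.
have [wf1 W01 _] := ev1.
set U := \bigcup_(v in N) (L v :\: K) in NU *.
have cU : #|U| <= d ^ j.+1.
  apply: (@leq_trans (#|N| * d ^ j)).
    apply: card_bigcup_le => v vN; have [h _] := sP v (subsetP NP v vN).
    exact: leq_trans (subset_leq_card (subsetDl _ _)) h.
  by rewrite expnS leq_mul2r cN (ltnW id) orbT.
have deg1 : deg (breaker_edges s1) u <= deg (breaker_edges s) u + 2 * (d * b).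
  apply: leq_trans (evolves_deg u ev1) _.
  by rewrite leq_add2l -mulnA leq_mul2l leq_mul2r (ltnW id) !orbT.
pose bad := [set v in P | #|L v| <= 2 * #|L v :&: (K :|: U)|].
have cbad : 4 * #|bad| <= p.
  apply: leq_trans cK; rewrite leq_mul2l /=.
  apply: leq_trans (card_overlapping _ lay) _; rewrite leq_mul2l; apply/orP; right.
  by apply: leq_trans (leq_of_leqif (leq_card_setU _ _)) _; rewrite addnC leq_add2r.
(* Excluded are fewer than [d], so at most p/16, old targets, p/4 vertices of [Q], p/8 + 2db <= p/4
   Breaker neighbours and p/4 vertices of [bad]: fewer than [p] together. *)
have [v vP] : exists2 v, v \in P & v \notin N :|: Q :|: nbrs (breaker_edges s1) u :|: bad.
  apply: exists_notin; apply: leq_trans cP.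
  apply: leq_ltn_trans (cardsU_le (cardsU_le (cardsU_le (leqnn _) (leqnn _)) deg1) (leqnn _)) _.
  rewrite cN; move: (deg _ _) #|bad| #|Q| cbad cQ degu => dg c q.
  by move: d_le_db dbp id d0; move: (d * b); clear; lia.
rewrite !in_setU !negb_or in_nbrs => /andP[/andP[/andP[vN vQ] vB] vbad].
have {vbad} vS : 2 * #|L v :&: (K :|: U)| <= #|L v|.
  by move: vbad; rewrite inE vP /=; lia.
have uv : u != v by apply/eqP=> e; have := colP v vP; rewrite -e colu; lia.
rewrite (_ : 2 = 1 + 1) //.
apply: (@forces_seq _ _ _ _
  (fun s2 => walker_at s2 = v /\ [set u; v] \in walker_edges s2) _ _ wf1).
  by apply: (@forces_step _ _ _ _ v); rewrite ?at1.
move=> s2 [at2 e2] ev2; have [wf2 W12 _] := ev2.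
(* The way back is open because the edge already belongs to Walker. *)
apply: (@forces_step _ _ _ _ u) => //; rewrite ?at2 1?eq_sym //.
  by rewrite setUC; have [/disjointFr/(_ e2)->] := wf2.
move=> s3 ev3 at3 _; have [wf3 W23 _] := ev3; split=> //; exists (v |: N); split.
- by rewrite subUset sub1set vP.
- by rewrite cardsU1 vN cN.
- apply/pred0P=> z /=; apply/negP=> /andP[]; rewrite in_setU1 => /orP[/eqP->|zN zQ].
    by rewrite (negPf vQ).
  by have := disjointFr NQ zN; rewrite zQ.
- move=> z; rewrite in_setU1 => /orP[/eqP->|/NW]; first exact: (subsetP W23).
  by move=> h; apply/(subsetP W23)/(subsetP W12).
rewrite big_setU1 //= -/U.
have -> : #|(L v :\: K) :|: U| = #|U| + #|L v :\: (K :|: U)|.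
  have -> : (L v :\: K) :|: U = U :|: (L v :\: (K :|: U)).
    by apply/setP=> z; rewrite !inE; case: (z \in U); rewrite ?orbT ?orbF //=.
  have := cardsUI U (L v :\: (K :|: U)); rewrite (_ : U :&: _ = set0) ?cards0 ?addn0 //.
  by apply/setP=> z; rewrite !inE; case: (z \in U); rewrite ?orbT ?andbF.
rewrite mulnDr mulSn addnC leq_add //; have [_ h] := sP v vP.
apply: leq_trans h _; rewrite expnSr -mulnA leq_mul2l; apply/orP; right.
by have := cardsID (K :|: U) (L v); move: vS; clear; lia.
Qed.

Definition light s := 4 * deg (breaker_edges s) (walker_at s) <= p.

Definition class j : {set 'I_n} := [set x | col x == j].

(** Counting edge ends, [p] times the number of heavy vertices is at most 32 times the number of
    Breaker's edges. The factor [c] is left free because different fractions of [p] are needed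
    later. *)
Lemma card_heavy_vertices s : wf_board s -> forall c, c * (32 * #|breaker_edges s|) <= p * p ->
  c * #|[set x | p <= 16 * deg (breaker_edges s) x]| <= p.
Proof.
move=> [_ BK] c cB.
have p0 : 0 < p by move: b_le_db b0 dbp; move: (d * b); clear; lia.
rewrite -(leq_pmul2r p0); apply: leq_trans cB.
have := card_high_degree p 16 BK; rewrite -mulnA => h.
by rewrite leq_mul2l; apply/orP; right; apply: leq_trans h _; clear; lia.
Qed.

(** Of 2p candidates, at most [p] lie in [A], p/4 are cut off from Walker's position, p/4 have large
    Breaker degree, and one is the position itself. *)
Lemma exists_light_target j A s : wf_board s -> light s -> #|A| <= p ->
  2 * p <= #|class j| -> 128 * #|breaker_edges s| <= p * p ->
  exists u, [/\ col u = j, u \notin A, walker_at s != u,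
    [set walker_at s; u] \notin breaker_edges s & 16 * deg (breaker_edges s) u < p].
Proof.
move=> wf li cA cC cB; pose H := [set x | p <= 16 * deg (breaker_edges s) x].
have cH : 4 * #|H| <= p by apply: card_heavy_vertices => //; apply: leq_trans cB; clear; lia.
have [u uC] : exists2 u, u \in class j &
    u \notin A :|: [set walker_at s] :|: nbrs (breaker_edges s) (walker_at s) :|: H.
  apply: exists_notin; apply: leq_trans cC.
  apply: leq_ltn_trans (cardsU_le (cardsU_le (cardsU_le cA (leqnn _)) (leqnn _)) (leqnn _)) _.
  move: li cH; rewrite /light cards1 -/(deg _ _); move: (deg _ _) #|H| => dg h.
  by move: b_le_db b0 dbp; move: (d * b); clear; lia.
rewrite !in_setU !negb_or in_nbrs in_set1 => /andP[/andP[/andP[uA uat] uB]].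
rewrite inE -ltnNge => uH; exists u; split=> //; last by rewrite eq_sym.
by move: uC; rewrite inE => /eqP.
Qed.

Definition visited j P L Q K A s := [/\ star j P L Q K (walker_at s) d s, light s,
  col (walker_at s) = j.+1 & walker_at s \notin A].

Lemma force_visit j P L Q K A s :
  wf_board s -> layer (walker_edges s) j P L -> light s -> #|A| <= p ->
  2 * p <= #|class j.+1| -> 128 * #|breaker_edges s| <= p * p ->
  4 * #|Q| <= p -> 4 * (2 ^ j.+1 * 4 ^ j * (d ^ j.+1 + #|K|)) <= p ->
  forces b (2 * d).+1 (visited j P L Q K A) s.
Proof.
move=> wf lay li cA cC cB cQ cK.
have [u [colu uA atu uB du]] := exists_light_target wf li cA cC cB.
rewrite -add1n.
apply: (@forces_seq _ _ _ _ (fun s1 => walker_at s1 = u) _ _ wf).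
  by apply: (@forces_step _ _ _ _ u).
move=> s1 at1 ev1; have [wf1 W01 _] := ev1.
have d1 := evolves_deg u ev1.
have d1' : 8 * deg (breaker_edges s1) u <= p.
  by move: d1 du b_le_db dbp; rewrite mul1n; move: (d * b); clear; lia.
have h := force_star wf1 (layerS W01 lay) at1 colu d1' cQ cK (leqnn d).
have := forces_evolves wf1 h; apply: forces_mono => s2 [st2 ev2]; have [at2 _] := st2.
split; rewrite ?at2 //.
(* The degree was below p/16 when [u] was chosen; the step to [u] adds at most b <= p/16 and the
   star at most 2db <= p/8. *)
rewrite /light at2; have := evolves_deg u ev2; rewrite -mulnA.
by move: d1 du b_le_db dbp; rewrite mul1n; move: (d * b); clear; lia.
Qed.

Definition stage j P L r s := light s /\ exists P' (N : 'I_n -> {set 'I_n}), [/\ #|P'| = r,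
  forall u, u \in P' -> col u = j.+1,
  forall u, u \in P' -> [/\ N u \subset P, #|N u| = d,
    forall v, v \in N u -> [set u; v] \in walker_edges s &
    d ^ j.+1 <= 2 ^ j.+1 * #|\bigcup_(v in N u) L v|] &
  forall v, #|[set u in P' | v \in N u]| <= 4 * d].

Lemma force_stage j P L s r :
  wf_board s -> layer (walker_edges s) j P L -> light s ->
  2 * p <= #|class j.+1| ->
  128 * (#|breaker_edges s| + p * (2 * d).+1 * b) <= p * p ->
  4 * (2 ^ j.+1 * 4 ^ j * d ^ j.+1) <= p -> r <= p ->
  forces b (r * (2 * d).+1) (stage j P L r) s.
Proof.
move=> wf lay li cC cB cK; elim: r => [|r IH] rp.
  split=> //; exists set0, (fun=> set0); split=> [|u|u|v]; rewrite ?inE ?cards0 //.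
  by rewrite (_ : [set u in _ | _] = set0) ?cards0 //; apply/setP=> u; rewrite !inE.
rewrite mulSn addnC; apply: (forces_seq wf (IH (ltnW rp))) => s1.
move=> [li1 [P' [N [cP' colP' NP' dP']]]] ev1; have [wf1 W01 _] := ev1.
(* Targets already used 4d times or more. Fewer than [p] stars with [d] targets each produce at most
   p/4 of them. *)
pose Q := [set v in P | 4 * d <= 1 * #|[set u in P' | v \in N u]|].
have cQ : 4 * #|Q| <= p.
  apply: leq_trans (ltnW rp); rewrite -(leq_pmul2r d0) -cP'.
  have := @card_heavy_le _ _ P P' (fun v u => v \in N u) (4 * d) 1 d.
  rewrite mul1n -/Q => h; rewrite -mulnA mulnCA; apply: h => u /NP'[_ <- _ _].
  by apply/subset_leq_card/subsetP=> v; rewrite inE => /andP[].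
have cB1 : 128 * #|breaker_edges s1| <= p * p.
  apply: leq_trans cB; rewrite leq_mul2l; apply/orP; right.
  apply: leq_trans (evolves_card ev1) _.
  by rewrite leq_add2l leq_mul2r leq_mul2r (ltnW rp) !orbT.
have := @force_visit j P L Q set0 P' s1 wf1 (layerS W01 lay) li1 _ cC cB1 cQ.
rewrite cards0 addn0 cP' => /(_ (ltnW rp) cK) h.
have := forces_evolves wf1 h; apply: forces_mono => s2 [[[_ st] li2 colu uP'] ev2].
have [wf2 W12 _] := ev2; move: st colu uP'; set u := walker_at s2.
move=> [N0 [N0P cN0 N0Q N0W N0U]] colu uP'; split=> //.
exists (u |: P'), (fun x => if x == u then N0 else N x); split.
- by rewrite cardsU1 uP' cP'.
- by move=> x; rewrite in_setU1 => /orP[/eqP->|/colP'].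
- move=> x; rewrite in_setU1; case: eqP => [-> _|_ /= /NP'[? ? h1 ?]].
    split=> //; rewrite expnS; move: N0U.
    by under eq_bigr do rewrite setD0.
  by split=> // v /h1; apply: (subsetP W12).
move=> v; have [vN0|nvN0] := boolP (v \in N0).
  have vQ : v \notin Q by have := disjointFr N0Q vN0 => ->.
  move: vQ; rewrite inE (subsetP N0P v vN0) /= mul1n -ltnNge => vQ.
  apply: leq_trans vQ; rewrite -add1n -(cards1 u).
  apply: leq_trans (leq_of_leqif (leq_card_setU _ _)); apply/subset_leq_card.
  by apply/subsetP=> x; rewrite !inE; case: (x =P u).
apply: leq_trans (dP' v); apply/subset_leq_card/subsetP=> x; rewrite !inE.
by case: (x =P u) => //= _; rewrite (negPf nvN0).
Qed.

(** An endpoint lies in at most (4d)^j of the old sets, and each old vertex is a target of at most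
    4d stars; hence the spread bound grows by a factor 4d only. *)
Lemma layer_stage j P L s : layer (walker_edges s) j P L -> stage j P L p s ->
  exists P' L', layer (walker_edges s) j.+1 P' L'.
Proof.
move=> [cP colP rP sP iP] [_ [P' [N [cP' colP' NP' dP']]]].
exists P', (fun u => \bigcup_(v in N u) L v); split=> //.
- by rewrite cP'.
- move=> u x uP' /bigcupP[v vN xv]; have [NP _ NW _] := NP' u uP'.
  split; first exact: colP'.
  by exists v; [exact: NW | apply: rP => //; apply: (subsetP NP)].
- move=> u uP'; have [NP cN _ hN] := NP' u uP'; split=> //.
  rewrite expnS -cN; apply: card_bigcup_le => v vN.
  by have [] := sP v (subsetP NP v vN); rewrite cN.
move=> x; rewrite expnSr; apply: leq_trans (leq_mul (iP x) (leqnn _)).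
apply: (@leq_trans #|\bigcup_(v in [set v in P | x \in L v]) [set u in P' | v \in N u]|).
  apply/subset_leq_card/subsetP=> u; rewrite inE => /andP[uP' /bigcupP[v vN xv]].
  have [NP _ _ _] := NP' u uP'.
  by apply/bigcupP; exists v; rewrite inE ?(subsetP NP v vN) ?uP'.
exact: card_bigcup_le.
Qed.

(** The set [U] collected at [u] has at least 4b endpoints, all of small Breaker degree, so few [w]
    have half of their edges to [U] blocked. After a step to another [w], the [b] edges of Breaker's
    answer cannot block the rest. The cycle consists of [w], [u] and the j+1 further vertices of a
    descending path. *)
Lemma force_last_stage j P L s :
  wf_board s -> layer (walker_edges s) j P L -> light s ->
  2 * p <= #|class j.+1| -> 2 * p <= #|class j.+2| ->
  128 * #|breaker_edges s| <= p * p ->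
  8 * (2 ^ j.+1 * 4 ^ j * d ^ j.+1) <= p ->
  8 * (2 ^ j.+1 * 4 ^ j) * (32 * #|breaker_edges s|) <= p * p ->
  64 * (d * b) <= p -> 2 ^ j.+1 * (4 * b) <= d ^ j.+1 ->
  forces b ((2 * d).+1 + (1 + 1)) (fun s => has_cycle j.+3 (walker_edges s)) s.
Proof.
move=> wf lay li cC cC' cB cK cKB dbp' hb.
have [cP colP rP sP iP] := lay.
pose K := [set x | p <= 16 * deg (breaker_edges s) x].
have cK' : 4 * (2 ^ j.+1 * 4 ^ j * (d ^ j.+1 + #|K|)) <= p.
  have := card_heavy_vertices wf cKB; rewrite -/K; move: cK #|K|.
  move: (2 ^ j.+1 * 4 ^ j) (d ^ j.+1) => a c cK x; rewrite mulnDr -mulnA.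
  by move: (a * c) (a * x) cK; clear; lia.
apply: (forces_seq wf (force_visit (Q := set0) (A := set0) wf lay li _ cC cB _ cK'));
  rewrite ?cards0 //.
move=> s1 [[_ [N [NP cN _ NW NU]]] li1 colu _] ev1; have [wf1 W01 _] := ev1.
set u := walker_at s1 in NW colu; set U := \bigcup_(v in N) _ in NU.
have cU : 4 * b <= #|U|.
  have e2 : 0 < 2 ^ j.+1 by rewrite expn_gt0.
  by rewrite -(leq_pmul2l e2); apply: leq_trans hb _; rewrite expnS.
have rU x : x \in U -> reach (walker_edges s1) j.+1 u x.
  move=> /bigcupP[v vN]; rewrite in_setD => /andP[_ xL]; split=> //.
  exists v; first exact: NW.
  by apply: reachS W01 _; apply: rP => //; apply: (subsetP NP).
(* Outside [K] the degree was below p/16, and the visit adds at most 3db <= 3p/64. *)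
have dU x : x \in U -> deg (breaker_edges s1) x <= p %/ 8.
  move=> /bigcupP[v vN]; rewrite !inE -ltnNge => /andP[xK _].
  have := evolves_deg x ev1; move: xK dbp' b_le_db.
  rewrite [(2 * d).+1 * b]mulSn -[2 * d * b]mulnA; move: (d * b).
  by move: (deg _ _) (deg _ _); clear; lia.
have U0 : 0 < #|U| by move: cU b0; clear; lia.
pose H := [set w in class j.+2 | #|U| <= 2 * #|[set x in U | [set w; x] \in breaker_edges s1]|].
have cH : #|H| <= 2 * (p %/ 8).
  rewrite -(leq_pmul2r U0).
  have := @card_heavy_le _ _ (class j.+2) U (fun w x => [set w; x] \in breaker_edges s1)
    #|U| 2 (p %/ 8); rewrite -/H => h.
  rewrite -mulnA [(_ %/ _) * _]mulnC; apply: h => x /dU; apply: leq_trans.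
  by apply/subset_leq_card/subsetP=> w; rewrite in_nbrs inE setUC => /andP[].
have [w wC] : exists2 w, w \in class j.+2 & w \notin nbrs (breaker_edges s1) u :|: H.
  apply: exists_notin; apply: leq_trans cC'.
  apply: leq_ltn_trans (cardsU_le (leqnn _) cH) _.
  move: li1; rewrite /light /deg; move: #|nbrs _ _| dbp b_le_db b0; move: (d * b); clear; lia.
rewrite in_setU negb_or in_nbrs => /andP[wB wH].
have colw : col w = j.+2 by move: wC; rewrite inE => /eqP.
have uw : u != w by apply/eqP=> e; move: colw; rewrite -e colu; clear; lia.
rewrite inE wC andTb -ltnNge in wH.
apply: (@forces_seq _ _ _ _
  (fun s2 => walker_at s2 = w /\ [set u; w] \in walker_edges s2) _ _ wf1).
  by apply: (@forces_step _ _ _ _ w).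
move=> s2 [at2 uwW] ev2; have [wf2 W12 [F BF cF]] := ev2.
have [x xU xB] : exists2 x, x \in U & x \notin nbrs (breaker_edges s2) w.
  pose X := [set x in U | [set w; x] \in breaker_edges s1] :|: nbrs F w.
  have [|x xU xX] := @exists_notin _ U X.
    apply: leq_ltn_trans (cardsU_le (leqnn _) (leq_trans (deg_le_card F w) cF)) _.
    by move: wH cU; rewrite mul1n; move: #|_| #|_|; clear; lia.
  by exists x => //; move: xX; rewrite !inE xU BF in_setU.
have ru := rU x xU; have [q [sq pq lq uq cq]] := reach_path ru.
rewrite in_nbrs in xB.
have wx : w != x.
  by apply/eqP=> e; have := cq x; rewrite -lq mem_last lq -e colw => /(_ isT); clear; lia.
apply: (@forces_step _ _ _ _ x) => //; rewrite ?at2 //.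
move=> s3 ev3 at3 wxW; have [wf3 W23 _] := ev3.
exists (w :: u :: q); split; first by rewrite /= sq.
have sub y z : adj (walker_edges s1) y z -> adj (walker_edges s3) y z.
  by move=> h; apply/(subsetP W23)/(subsetP W12).
apply/andP; split; last first.
  by rewrite cons_uniq uq andbT; apply/negP=> /cq; rewrite colw; clear; lia.
rewrite /= rcons_path (sub_path sub pq) lq /= setUC (subsetP W23) //=.
by rewrite setUC.
Qed.

End Walker.

(** * Walker's strategy: the constants *)

Section WalkerWins.
Variables (n b d p k : nat) (col : 'I_n -> nat).
Hypotheses (k3 : 3 <= k) (b0 : 0 < b) (d0 : 0 < d).
Hypotheses (dbp : 768 * (k * 8 ^ k) * (d * b) <= p) (dkp : 8 * (8 ^ k * d ^ k.-2) <= p).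
Hypothesis (classp : forall i, i < k -> 2 * p <= #|class col i|).

Lemma small_db : 768 * (d * b) <= p.
Proof.
apply: leq_trans dbp; rewrite leq_mul2r -[X in X <= _]muln1 leq_mul2l /= muln_gt0 expn_gt0.
by rewrite (ltnW (ltnW k3)) orbT.
Qed.

Lemma small_branching j : j < k.-2 -> 8 * (2 ^ j.+1 * 4 ^ j * d ^ j.+1) <= p.
Proof.
move=> jk; apply: leq_trans dkp; rewrite leq_mul2l /=.
apply: leq_mul; last by rewrite leq_pexp2l.
apply: (@leq_trans (2 ^ j.+1 * 4 ^ j.+1)); first by rewrite leq_mul2l leq_pexp2l ?orbT.
by rewrite -expnMn leq_pexp2l //; move: k3 jk; clear; lia.
Qed.

(** In [t] stages of p(2d+1) <= 3pd rounds Breaker claims at most 3kpdb edges. The 768 is 3 times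
    256, and 256 = 8 * 32 is the factor needed in the last stage. *)
Lemma small_budget t : t <= k ->
  768 * 8 ^ k * (t * (p * (2 * d).+1) * b) <= 3 * (p * p).
Proof.
move=> tk.
apply: (@leq_trans (768 * 8 ^ k * (k * (p * (3 * d)) * b))).
  do !apply: leq_mul => //.
  by move: d0; clear; lia.
apply: (@leq_trans (3 * (p * (768 * (k * 8 ^ k) * (d * b))))).
  by rewrite leq_eqVlt; apply/orP; left; apply/eqP; move: (8 ^ k); clear; lia.
by rewrite leq_mul2l leq_mul2l dbp !orbT.
Qed.

(** Layers are built up to class k-3; the vertices of the cycle in classes k-2 and k-1 are found in
    the last stage. *)
Lemma force_layers v0 j : j <= k - 3 ->
  forces b (j * (p * (2 * d).+1))
    (fun s => light p s /\ exists P L, layer d p col (walker_edges s) j P L)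
    (initial_board v0).
Proof.
have db16 : 16 * (d * b) <= p by move: small_db; move: (d * b); clear; lia.
elim: j => [|j IH] jk.
  split.
    rewrite /light /= (_ : deg _ _ = 0) //; apply/eqP; rewrite -leqn0 -(cards0 {set 'I_n}).
    exact: deg_le_card.
  exists (class col 0), (fun v => [set v]); apply: layer0.
    by apply: leq_trans (@classp 0 _); move: k3 p; clear; lia.
  by move=> v; rewrite inE => /eqP.
rewrite mulSn addnC; apply: (forces_seq (wf_initial v0) (IH (ltnW jk))).
move=> s [li [P [L lay]]] ev; have [wf _ _] := ev.
have jk2 : j.+1 <= k.-2 by move: jk k3; clear; lia.
have hst : forces b (p * (2 * d).+1) (stage d p col j P L p) s.
  apply: force_stage => //.
  - by apply: classp; move: k3 jk; clear; lia.
  - have cB := evolves_card ev; rewrite cards0 add0n in cB.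
    apply: (@leq_trans (128 * (j.+1 * (p * (2 * d).+1) * b))).
      by rewrite leq_mul2l mulSn mulnDl addnC leq_add2l cB.
    have := @small_budget j.+1; rewrite -mulnA.
    have jk' : j.+1 <= k by move: jk2; clear; lia.
    move=> /(_ jk'); have e8 : 0 < 8 ^ k by rewrite expn_gt0.
    move: (_ * b) (p * p) => x y; move: (8 ^ k) e8 => e e0 hx.
    have : x <= e * x by rewrite leq_pmull.
    by move: hx; move: (e * x); clear; lia.
  - by have := small_branching jk2; clear; lia.
have := forces_evolves wf hst; apply: forces_mono => s' [st ev'].
split; first by case: st.
by have [_ W _] := ev'; apply: layer_stage st => //; apply: layerS lay.
Qed.

Lemma walker_wins_layers (v0 : 'I_n) : 2 ^ k.-2 * (4 * b) <= d ^ k.-2 -> walker_wins n k b.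
Proof.
move=> hb; have db16 : 16 * (d * b) <= p by move: small_db; move: (d * b); clear; lia.
apply: (@forces_wins _ _ _ _ v0).
apply: (forces_seq (wf_initial v0) (force_layers v0 (leqnn _))).
move=> s [li [P [L lay]]] ev; have [wf _ _] := ev.
have cB := evolves_card ev; rewrite cards0 add0n in cB.
have e1 : (k - 3).+1 = k.-2 by move: k3; clear; lia.
have e3 : (k - 3).+3 = k by move: k3; clear; lia.
have cB' : 768 * (8 ^ k * #|breaker_edges s|) <= 3 * (p * p).
  rewrite mulnA.
  by apply: leq_trans (small_budget (leq_subr 3 k)); rewrite leq_mul2l cB orbT.
have e8 : 0 < 8 ^ k by rewrite expn_gt0.
rewrite -[X in has_cycle X]e3; apply: (@force_last_stage _ _ _ _ col b0 d0 db16 (k - 3) P L) => //.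
- by apply: classp; move: k3; clear; lia.
- by apply: classp; move: k3; clear; lia.
- have : #|breaker_edges s| <= 8 ^ k * #|breaker_edges s| by rewrite leq_pmull.
  move: cB'; set B := #|breaker_edges s|; move: (8 ^ k * B) (p * p); clearbody B; clear; lia.
- by apply: small_branching; rewrite -e1.
- have h : 2 ^ (k - 3).+1 * 4 ^ (k - 3) <= 8 ^ k.
    apply: (@leq_trans (2 ^ k * 4 ^ k)); last by rewrite -expnMn.
    by apply: leq_mul; rewrite leq_pexp2l //; move: k3; clear; lia.
  move: cB'; set B := #|breaker_edges s|; move: (2 ^ _ * _) h => a h.
  have : a * B <= 8 ^ k * B by rewrite leq_mul2r h orbT.
  rewrite -mulnA [a * (_ * _)]mulnCA; move: (8 ^ k * B) (a * B) (p * p); clear; lia.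
- by move: small_db; move: (d * b); clear; lia.
- by rewrite e1.
Qed.

End WalkerWins.

Lemma card_block n k m i : k * m <= n -> i < k -> 0 < m ->
  m <= #|[set x : 'I_n | x %/ m == i]|.
Proof.
move=> kmn ik m0.
have lt (y : 'I_m) : i * m + y < n.
  apply: leq_trans kmn; apply: (@leq_trans (i.+1 * m)); last by rewrite leq_mul2r ik orbT.
  by rewrite mulSn addnC ltn_add2r.
pose f (y : 'I_m) : 'I_n := Ordinal (lt y).
have f_inj : injective f by move=> y z /(congr1 val) /= /addnI /val_inj.
rewrite -[X in X <= _](card_ord m) -cardsT -(card_imset _ f_inj).
apply/subset_leq_card/subsetP=> x /imsetP[y _ ->].
by rewrite inE /= divnMDl // divn_small // addn0.
Qed.

(** Here 3072 = 4 * 768, and the second [k] also stems from n <= 4kp: a bound by [n] on this factor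
    times db becomes the bound 768 k 8^k db <= p. *)
Definition walker_factor k := 3072 * (k * k * 8 ^ k).

Lemma walker_factor_gt0 k : 3 <= k -> 0 < walker_factor k.
Proof. by move=> k3; rewrite /walker_factor !muln_gt0 expn_gt0 /=; lia. Qed.

(** The classes are blocks of consecutive vertices. A large [d] makes the bias positive and absorbs
    the constants of the branching condition. *)
Lemma walker_wins_bias n k d : 3 <= k -> walker_factor k <= d -> d ^ k.-1 <= n ->
  walker_wins n k (d ^ k.-2 %/ walker_factor k).
Proof.
move=> k3 Kd dn; have K0 := walker_factor_gt0 k3; set K := walker_factor k in Kd K0 *.
have d0 : 0 < d by apply: leq_trans Kd.
have e8 : 0 < 8 ^ k by rewrite expn_gt0.
have ek : k.-1 = k.-2.+1 by move: k3; clear; lia.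
have kK : 16 * k <= K.
  rewrite /K /walker_factor; apply: (@leq_trans (3072 * (k * 1 * 1))).
    by clear; lia.
  by rewrite leq_mul2l /= leq_mul // leq_mul2l; move: k3; clear; lia.
have Kn : K <= n.
  apply: leq_trans dn; apply: leq_trans Kd _.
  by rewrite -{1}(expn1 d) leq_pexp2l //; move: k3; clear; lia.
set b := d ^ k.-2 %/ K.
have b0 : 0 < b.
  rewrite divn_gt0 //; apply: leq_trans Kd _.
  by rewrite -{1}(expn1 d) leq_pexp2l //; move: k3; clear; lia.
have bK : b * K <= d ^ k.-2 := leq_trunc_div _ _.
pose m := n %/ k; pose p := m %/ 2.
have k0 : 0 < k by move: k3; clear; lia.
have mn : k * m <= n by rewrite mulnC leq_trunc_div.
(* As n < (m+1)k and m >= 16, halving [m] with rounding still leaves m+1 <= 4p. *)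
have np : n <= 4 * k * p.
  have h1 : n < m.+1 * k by rewrite -ltn_divLR.
  have m16 : 16 <= m by rewrite leq_divRL // (leq_trans _ Kn).
  have h2 : m.+1 <= 4 * p by rewrite /p; move: m16; clear; lia.
  apply: ltnW; apply: leq_trans h1 _.
  by rewrite -mulnA [k * p]mulnC mulnA leq_mul2r h2 orbT.
have p2m : 2 * p <= m by rewrite mulnC leq_trunc_div.
have m0 : 0 < m by rewrite divn_gt0 //; move: kK Kn; clear; lia.
have n0 : 0 < n by move: K0 Kn; clear; lia.
have k40 : 0 < 4 * k by rewrite muln_gt0.
apply: (@walker_wins_layers n b d p k (fun x => x %/ m) k3 b0 d0 _ _ _ (Ordinal n0)).
- rewrite -(leq_pmul2l k40); apply: leq_trans np; apply: leq_trans dn.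
  rewrite ek expnS; apply: leq_trans (leq_mul (leqnn d) bK).
  by rewrite /K /walker_factor leq_eqVlt; apply/orP; left; apply/eqP; move: (8 ^ k); clear; lia.
- rewrite -(leq_pmul2l k40); apply: leq_trans np; apply: leq_trans dn.
  rewrite ek expnS !mulnA leq_mul2r; apply/orP; right; apply: leq_trans Kd.
  rewrite /K /walker_factor; apply: (@leq_trans (3072 * (k * 1 * 8 ^ k))).
    by move: (8 ^ k); clear; lia.
  by rewrite leq_mul2l leq_mul2r leq_mul2l k0 !orbT.
- move=> i ik; apply: leq_trans p2m _; exact: card_block mn ik m0.
- apply: leq_trans bK; rewrite mulnA mulnC leq_mul2l; apply/orP; right.
  rewrite /K /walker_factor; apply: (@leq_trans (4 * (1 * 1 * 8 ^ k))).
    rewrite mulnC leq_mul2l !mul1n /=; apply: (@leq_trans (8 ^ k.-2)).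
      by rewrite leq_exp2r //; move: k3; clear; lia.
    by rewrite leq_pexp2l //; clear; lia.
  by apply: leq_mul => //; rewrite leq_mul2r leq_mul ?orbT.
Qed.

(** * The largest winning bias *)

Lemma nat_root_exists c m n : c ^ m.+1 <= n ->
  exists d, [/\ c <= d, d ^ m.+1 <= n & n < d.+1 ^ m.+1].
Proof.
move=> cn; pose P d := d ^ m.+1 <= n.
have Pn d : P d -> d <= n.
  apply: leq_trans; case: d => // d.
  by rewrite -{1}(expn1 d.+1) leq_pexp2l.
case: (@ex_maxnP P n (ex_intro _ c cn) Pn) => d Pd maxd.
by exists d; split=> //; [exact: maxd | rewrite ltnNge; apply/negP=> /maxd; rewrite ltnn].
Qed.

Lemma largest_winning_bias_exists n k b M : walker_wins n k b ->
  (forall b', walker_wins n k b' -> b' <= M) ->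
  exists2 b', largest_winning_bias n k b' & b <= b'.
Proof.
move=> wb HM; pose P b' := `[< walker_wins n k b' >].
have Pb : P b by apply/asboolP.
have PM b' : P b' -> b' <= M by move=> /asboolP; exact: HM.
case: (@ex_maxnP P M (ex_intro _ b Pb) PM) => b' /asboolP wb' maxb.
by exists b'; [split=> // b'' wb''; apply: maxb; apply/asboolP | exact: maxb].
Qed.

Lemma largest_winning_bias_bounds k n : 3 <= k -> walker_factor k ^ k.-1 <= n ->
  exists b d, [/\ largest_winning_bias n k b, 0 < d, d ^ k.-1 <= n < d.+1 ^ k.-1,
    d ^ k.-2 <= 2 * walker_factor k * b & b <= k.+1 * d.+1 ^ k.-2].
Proof.
move=> k3; have K0 := walker_factor_gt0 k3; set K := walker_factor k in K0 *.
have -> : k.-1 = k.-2.+1 by lia.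
move=> /nat_root_exists[d [Kd dn nd]]; have d0 : 0 < d by exact: leq_trans Kd.
have ek : k.-2.+1 = k.-1 by lia.
have up b : walker_wins n k b -> b <= k.+1 * d.+1 ^ k.-2.
  by move=> /breaker_prevents h; apply/ltnW/h; rewrite // -ek.
have [|b lb Kb] := @largest_winning_bias_exists n k (d ^ k.-2 %/ K) _ _ up.
  by apply: walker_wins_bias; rewrite // -ek.
exists b, d; split=> //; [by rewrite dn | | by apply: up; case: lb].
(* The quotient q is at least 1, so d^(k-2) < (q+1)K <= 2Kq. *)
have q0 : 0 < d ^ k.-2 %/ K.
  rewrite divn_gt0 //; apply: leq_trans Kd _.
  by rewrite -{1}(expn1 d) leq_pexp2l //; move: k3; clear; lia.
apply: ltnW; apply: leq_trans (ltn_ceil (d ^ k.-2) K0) _.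
rewrite mulnC -mulnA mulnCA leq_mul2l; apply/orP; right.
by move: q0 Kb; clear; move: (_ %/ _); lia.
Qed.

(* Real powers and the asymptotic order *)
From mathcomp Require Import all_order all_algebra.
From mathcomp Require Import all_classical all_reals all_analysis.
Import Order.TTheory GRing.Theory Num.Theory.
Import numFieldNormedType.Exports.
Local Open Scope classical_set_scope.
Local Open Scope ring_scope.

(** The exponent turns m^(k-1) into m^(k-2) exactly, so monotonicity of the power carries over the
    bounds on [n]. *)
Lemma powR_root_bounds (R : realType) (k n d : nat) : (3 <= k)%N ->
  (d ^ k.-1 <= n < d.+1 ^ k.-1)%N ->
  (d ^ k.-2)%:R <= (n%:R : R) `^ ((k%:R - 2) / (k%:R - 1)) <= (d.+1 ^ k.-2)%:R.
Proof.
move=> k3 /andP[dn nd]; set r : R := _ / _.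
have e1 : k%:R - 1 = k.-1%:R :> R by rewrite -[in LHS](ltn_predK k3) -natr1 addrK.
have e2 : k%:R - 2 = k.-2%:R :> R.
  by rewrite -(natrB _ (ltnW k3)) subn2.
have k1 : (k.-1%:R : R) != 0.
  by rewrite pnatr_eq0; case: k k3 {dn nd r e1 e2} => [|[|k]].
have r0 : 0 <= r by rewrite /r e1 e2 divr_ge0.
have pw m : ((m ^ k.-1)%:R : R) `^ r = (m ^ k.-2)%:R.
  rewrite !natrX -!powR_mulrn // -powRrM; congr (_ `^ _).
  by rewrite /r e1 e2 mulrC divfK.
rewrite -!pw; apply/andP; split; apply: ge0_ler_powR => //; rewrite ?nnegrE ?ler0n //.
  by rewrite ler_nat.
by rewrite ler_nat ltnW.
Qed.

Theorem theorem1p3 (R : realType) (k : nat) (hk : (3 <= k)%N) :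
  exists b : nat -> nat,
    (\forall n \near \oo, largest_winning_bias n k (b n)) /\
    (fun n : nat => (b n)%:R : R^o) =Theta_\oo
      (fun n : nat => n%:R `^ ((k%:R - 2) / (k%:R - 1)) : R^o).
Proof.
pose K := walker_factor k; have K0 : (0 < K)%N := walker_factor_gt0 hk.
have /choice[b bP] n : exists b, (K ^ k.-1 <= n)%N -> largest_winning_bias n k b /\
    exists d, [/\ (0 < d)%N, (d ^ k.-1 <= n < d.+1 ^ k.-1)%N,
      (d ^ k.-2 <= 2 * K * b)%N & (b <= k.+1 * d.+1 ^ k.-2)%N].
  (* Below the threshold 0 is a default value. *)
  have [Kn|nK] := leqP (K ^ k.-1) n; last by exists 0%N.
  have [b [d [? ? ? ? ?]]] := largest_winning_bias_bounds hk Kn.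
  by exists b => _; split=> //; exists d.
exists b; split.
  by exists (K ^ k.-1)%N => // n /= /bP[].
rewrite eqThetaE qualifE; apply/asboolP.
(* As d >= 1, (d+1)^(k-2) <= c d^(k-2). The factor [c] enters both constants: the power of [n] lies
   between d^(k-2) and (d+1)^(k-2), and the upper bound on the bias is in terms of d+1. *)
pose c := (2 ^ k.-2)%N; have c0 : (0 < c)%N by rewrite expn_gt0.
have cK0 : (0 < c * (2 * K))%N by rewrite muln_gt0 c0 muln_gt0.
exists ((c * (2 * K))%:R^-1, (k.+1 * c)%:R) => /=.
  by rewrite invr_gt0 !ltr0n cK0 muln_gt0 c0.
exists (K ^ k.-1)%N => // n /= /bP[_ [d [d0 dn bl bu]]].
have /andP[pl pu] := @powR_root_bounds R k n d hk dn.
rewrite [X in _ * X]ger0_norm ?powR_ge0 // [X in _ <= _ * X]ger0_norm ?powR_ge0 //.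
rewrite ger0_norm ?ler0n //.
have dc : (d.+1 ^ k.-2 <= c * d ^ k.-2)%N.
  rewrite -expnMn leq_exp2r; first by rewrite mul2n -addnn -addn1 leq_add2l.
  by move: hk; case: (k) => [|[|[|]]].
split.
  rewrite ler_pdivrMl ?ltr0n //; apply: le_trans pu _.
  rewrite -natrM ler_nat; apply: leq_trans dc _.
  by rewrite -mulnA leq_mul2l bl orbT.
apply: (@le_trans _ _ ((k.+1 * c)%:R * (d ^ k.-2)%:R)).
  by rewrite -natrM ler_nat -mulnA (leq_trans bu) // leq_mul2l dc orbT.
by rewrite ler_pM2l // ltr0n muln_gt0.
Qed.
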